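(* Let $X,Y$ be Banach spaces over $\mathbb{K}\in\{\mathbb{R},\mathbb{C}\}$, let $G\in L(X,Y)$ with $\|G\|=1$, and assume that $\|\cdot\|_G$ is a norm on $L(X,Y)$. Let $T\in L(X,Y)$ satisfy $\|T\|_G=1$. Let $\mathcal{W}(T)\subset L(X,Y)^*$ be the set of all weak*-limits of nets $(\psi_{x_\alpha,y_\alpha^*})$ where $(x_\alpha,y_\alpha^* )\subset S_X\times S_{Y^*}$ is a net with $\|Gx_\alpha\|\to1$ and $y_\alpha^*(Tx_\alpha)\to1$. The following are equivalent: (i) $T$ is a smooth point of the unit ball of $(L(X,Y),\|\cdot\|_G)$; (ii) $\mathcal{W}(T)=\{\varphi\}$ for a single functional $\varphi$ with $\varphi(T)=1$.
   Context: $S_X$ is the unit sphere of $X$, $Y^*$ the dual of $Y$. For $x\in X$, $y^*\in Y^*$, $\psi_{x,y^*}(S)=y^*(Sx)$ for $S\in L(X,Y)$. The $G$-norm is $\|T\|_G := \inf_{\delta>0}\sup\{\|Tx\|: x\in S_X,\ \|Gx\|>1-\delta\}$. $T$ with $\|T\|_G=1$ is a smooth point of the unit ball of $(L(X,Y),\|\cdot\|_G)$ if there is exactly one functional $f$ in the unit sphere of $(L(X,Y),\|\cdot\|_G)^*$ with $f(T)=1$. *)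

(* Defs.v *)
From HB Require Import structures.
From mathcomp Require Import all_boot all_order all_algebra.
From mathcomp Require Import all_classical all_reals all_analysis.
From mathcomp Require Import complex.

Set Implicit Arguments.
Unset Strict Implicit.
Unset Printing Implicit Defensive.

Import Order.TTheory GRing.Theory Num.Theory.
Import numFieldNormedType.Exports.
Local Open Scope classical_set_scope.
Local Open Scope ring_scope.

(* Generic setting: scalar field K (R or R[i]), a real type R of "norm values",
   and toR : K -> R reading a (real) norm value of K as an element of R
   (identity for K = R, real part for K = R[i]). *)
Section Defs.
Variables (R : realType) (K : numFieldType) (toR : K -> R).

Definition is_linear (X Y : normedModType K) (f : X -> Y) : Prop :=
  forall (a : K) (x y : X), f (a *: x + y) = a *: f x + f y.

Definition bounded_op (X Y : normedModType K) (f : X -> Y) : Prop :=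
  is_linear f /\ continuous f.

Definition unit_sphere (X : normedModType K) : set X := [set x | `|x| = 1].
Arguments unit_sphere : clear implicits.

Definition opnorm (X Y : normedModType K) (f : X -> Y) : R :=
  sup [set toR `|f x| | x in unit_sphere X].

Definition bounded_functional (Y : normedModType K) (g : Y -> K) : Prop :=
  (forall (a : K) (y z : Y), g (a *: y + z) = a * g y + g z) /\ continuous g.

Definition functional_norm (Y : normedModType K) (g : Y -> K) : R :=
  sup [set toR `|g y| | y in unit_sphere Y].

Definition dual_sphere (Y : normedModType K) : set (Y -> K) :=
  [set g | bounded_functional g /\ functional_norm g = 1].
Arguments dual_sphere : clear implicits.

Definition Gnorm (X Y : normedModType K) (G T : X -> Y) : R :=
  inf [set sup [set toR `|T x| | x in
                 [set x | x \in unit_sphere X /\ 1 - d < toR `|G x|]]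
      | d in [set d : R | 0 < d]].

Definition Gnorm_is_norm (X Y : normedModType K) (G : X -> Y) : Prop :=
  [/\ (forall S : X -> Y, bounded_op S -> Gnorm G S = 0 -> forall x, S x = 0),
      (forall (a : K) (S : X -> Y), bounded_op S ->
         Gnorm G (fun x => a *: S x) = toR `|a| * Gnorm G S) &
      (forall S U : X -> Y, bounded_op S -> bounded_op U ->
         Gnorm G (fun x => S x + U x) <= Gnorm G S + Gnorm G U)].

(* Linear functionals on L(X,Y) are represented by maps (X -> Y) -> K;
   only their values on L(X,Y) matter. *)
Definition Gdual_functional (X Y : normedModType K) (G : X -> Y)
    (f : (X -> Y) -> K) : Prop :=
  (forall (a : K) (S U : X -> Y), bounded_op S -> bounded_op U ->
     f (fun x => a *: S x + U x) = a * f S + f U) /\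
  (exists C : R, forall S, bounded_op S -> toR `|f S| <= C * Gnorm G S).

Definition Gdual_norm (X Y : normedModType K) (G : X -> Y)
    (f : (X -> Y) -> K) : R :=
  sup [set toR `|f S| | S in [set S | bounded_op S /\ Gnorm G S <= 1]].

Definition Gdual_sphere (X Y : normedModType K) (G : X -> Y) :
    set ((X -> Y) -> K) :=
  [set f | Gdual_functional G f /\ Gdual_norm G f = 1].

Definition smooth_point (X Y : normedModType K) (G T : X -> Y) : Prop :=
  Gnorm G T = 1 /\
  exists f, f \in Gdual_sphere G /\ f T = 1 /\
    forall g, g \in Gdual_sphere G -> g T = 1 ->
      forall S, bounded_op S -> g S = f S.

Definition directed (I : Type) (le : I -> I -> Prop) : Prop :=
  [/\ (forall i, le i i),
      (forall i j k, le i j -> le j k -> le i k),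
      (exists i : I, True) &
      (forall i j, exists k, le i k /\ le j k)].

Definition net_cvg (I : Type) (le : I -> I -> Prop) (V : numFieldType)
    (u : I -> V) (l : V) : Prop :=
  forall e : V, 0 < e -> exists i0, forall i, le i0 i -> `|u i - l| < e.

Definition psi (X Y : normedModType K) (x : X) (y' : Y -> K) :
    (X -> Y) -> K := fun S => y' (S x).

Definition W_set (X Y : normedModType K) (G T : X -> Y) :
    set ((X -> Y) -> K) :=
  [set phi | exists (I : Type) (le : I -> I -> Prop)
                    (xs : I -> X) (ys : I -> Y -> K),
     [/\ directed le,
         (forall i, xs i \in unit_sphere X /\ ys i \in dual_sphere Y),
         net_cvg le (fun i => toR `|G (xs i)|) 1,
         net_cvg le (fun i => ys i (T (xs i))) 1 &
         (forall S, bounded_op S ->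
            net_cvg le (fun i => psi (xs i) (ys i) S) (phi S))]].

Definition W_singleton (X Y : normedModType K) (G T : X -> Y)
    (phi : (X -> Y) -> K) : Prop :=
  phi \in W_set G T /\
  forall phi', phi' \in W_set G T -> forall S, bounded_op S -> phi' S = phi S.

Definition thm311_claim : Prop :=
  forall (X Y : completeNormedModType K) (G T : X -> Y),
    bounded_op G -> opnorm G = 1 -> Gnorm_is_norm G ->
    bounded_op T -> Gnorm G T = 1 ->
    (smooth_point G T <->
     exists phi : (X -> Y) -> K, W_singleton G T phi /\ phi T = 1).

End Defs.

(* Main.v *)
Require Import Defs.
From HB Require Import structures.
From mathcomp Require Import all_boot all_order all_algebra.
From mathcomp Require Import all_classical all_reals all_analysis.
From mathcomp Require Import complex.
From mathcomp Require Import ring lra.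

(** Elements of [W(T)] are support functionals of the unit ball at [T], and
    [W(T)] is nonempty, so smoothness forces it to be a singleton.  Conversely
    let [g] be any support functional at [T] and [S] an operator.  Then
    [1 + t Re g(S) <= ||T + t S||_G] for [t > 0]; choosing [x_t] almost
    attaining this norm with [||G x_t|| > 1 - t], and [y_t] norming
    [(T + t S) x_t] (Hahn-Banach), gives [y_t(T x_t) -> 1] and
    [Re y_t(S x_t) >= Re g(S) - O(t)].  A limit along an ultrafilter is an
    element [phi] of [W(T)] with [Re phi(S) >= Re g(S)].  If [W(T)] has a
    single element this holds for every [S] with the same [phi], and hence
    [g = phi]. *)

Set Implicit Arguments.
Unset Strict Implicit.
Unset Printing Implicit Defensive.

Import Order.TTheory GRing.Theory Num.Theory.
Import numFieldNormedType.Exports.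
(* Imported again so that [Re] denotes [complex.Re]. *)
Import complex.
Local Open Scope classical_set_scope.
Local Open Scope ring_scope.

(** * Hahn-Banach *)

Section Sublinear.
Variables (R : realType) (V : lmodType R).
Implicit Types (p q : V -> R) (x y v : V).

Definition sublinear p : Prop :=
  (forall x y, p (x + y) <= p x + p y) /\
  (forall (a : R) x, 0 < a -> p (a *: x) <= a * p x).

Lemma sublinearZ p (a : R) x : sublinear p -> 0 <= a -> p (a *: x) = a * p x.
Proof.
move=> [_ pZ]; have pZgt0 b y : 0 < b -> p (b *: y) = b * p y.
  move=> b0; apply/eqP; rewrite eq_le pZ//=.
  rewrite -ler_pdivlMl// (le_trans _ (pZ b^-1 (b *: y) _)) ?invr_gt0//.
  by rewrite scalerA mulVf ?gt_eqF// scale1r.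
rewrite le_eqVlt => /predU1P[<-|]; last exact: pZgt0.
by have := pZgt0 2 0 (ltr0n _ 2); rewrite scale0r mul0r scaler0; lra.
Qed.

Lemma sublinear0 p : sublinear p -> p 0 = 0.
Proof. by move=> sp; rewrite -(scale0r 0) (sublinearZ 0 sp (lexx 0)) mul0r. Qed.

Lemma sublinear_ge_opp p x : sublinear p -> - p (- x) <= p x.
Proof. by move=> sp; have := sp.1 x (- x); rewrite subrr sublinear0//; lra. Qed.

Lemma sublinear_inf (A : V -> set R) :
  (forall x, has_inf (A x)) ->
  (forall x y r s, A x r -> A y s -> exists2 u, A (x + y) u & u <= r + s) ->
  (forall (a : R) x r, 0 < a -> A x r -> A (a *: x) (a * r)) ->
  sublinear (fun x => inf (A x)).
Proof.
move=> infA AD AZ; have inf_le x r : A x r -> inf (A x) <= r.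
  by move=> Ar; apply: ge_inf => //; exact: (infA x).2.
split=> [x y|a x a0].
- rewrite -lerBlDr; apply: lb_le_inf => [|r Ar]; first exact: (infA x).1.
  rewrite lerBlDr -lerBlDl.
  apply: lb_le_inf => [|s As]; first exact: (infA y).1.
  have [u /inf_le inf_u u_le] := AD _ _ _ _ Ar As.
  by rewrite lerBlDl; exact: le_trans inf_u u_le.
- rewrite -ler_pdivrMl//; apply: lb_le_inf => [|r Ar]; first exact: (infA x).1.
  by rewrite ler_pdivrMl//; apply: inf_le; exact: AZ.
Qed.

Definition reduce_along_values p v x : set R :=
  [set p (x + t *: v) - t * p v | t in [set t | 0 <= t]].

(* The largest sublinear function below [p] whose value at [- v] is [- p v].  A
   minimal [p] coincides with it for every [v], which makes [p] additive. *)
Definition reduce_along p v x : R := inf (reduce_along_values p v x).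

Lemma reduce_along_has_inf p v x : sublinear p ->
  has_inf (reduce_along_values p v x).
Proof.
move=> sp; split; first by exists (p (x + 0 *: v) - 0 * p v), 0 => /=.
exists (- p (- x)) => _ [t t0 <-]; rewrite -(sublinearZ _ sp t0).
by have := sp.1 (x + t *: v) (- x); rewrite [x + _]addrC addrK; lra.
Qed.

Lemma reduce_along_le p v x t : sublinear p -> 0 <= t ->
  reduce_along p v x <= p (x + t *: v) - t * p v.
Proof.
move=> sp t0; apply: ge_inf; last by exists t.
exact: (reduce_along_has_inf v x sp).2.
Qed.

Lemma reduce_along_le_self p v x : sublinear p -> reduce_along p v x <= p x.
Proof.
move=> sp; have := reduce_along_le v x sp (lexx 0).
by rewrite scale0r addr0 mul0r subr0.
Qed.

Lemma sublinear_reduce_along p v : sublinear p -> sublinear (reduce_along p v).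
Proof.
move=> sp.
apply: sublinear_inf => [x|x y _ _ [s s0 <-] [t t0 <-]|a x _ a0 [t t0 <-]].
- exact: reduce_along_has_inf.
- exists (p (x + y + (s + t) *: v) - (s + t) * p v).
    by exists (s + t) => //=; exact: addr_ge0.
  by have := sp.1 (x + s *: v) (y + t *: v); rewrite addrACA -scalerDl; lra.
- exists (a * t); first exact: mulr_ge0 (ltW a0) t0.
  by rewrite -scalerA -scalerDr (sublinearZ _ sp (ltW a0)); ring.
Qed.

Lemma sublinear_chain_inf (C : set (V -> R)) p :
  C !=set0 -> (forall q, C q -> sublinear q /\ forall x, q x <= p x) ->
  total_on C (fun q1 q2 => forall x, q1 x <= q2 x) ->
  sublinear (fun x => inf [set q x | q in C]) /\
  forall q x, C q -> inf [set q x | q in C] <= q x.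
Proof.
move=> [q0 Cq0] Cp Ctot.
have infC x : has_inf [set q x | q in C].
  split; first by exists (q0 x), q0.
  exists (- p (- x)) => _ [q Cq <-].
  rewrite (le_trans _ (sublinear_ge_opp x (Cp q Cq).1))// lerN2.
  exact: (Cp q Cq).2.
split; last by move=> q x Cq; apply: ge_inf; [exact: (infC x).2|exists q].
apply: sublinear_inf => // [x y _ _ [q Cq <-] [q' Cq' <-]|a x _ a0 [q Cq <-]].
- have [qq'|q'q] := Ctot q q' Cq Cq'.
  + exists (q (x + y)); first by exists q.
    by rewrite (le_trans ((Cp q Cq).1.1 x y))// lerD2l.
  + exists (q' (x + y)); first by exists q'.
    by rewrite (le_trans ((Cp q' Cq').1.1 x y))// lerD2r.
- by exists q => //; rewrite (sublinearZ _ (Cp q Cq).1 (ltW a0)).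
Qed.

Definition minimal_sublinear q : Prop :=
  sublinear q /\ forall q', sublinear q' -> (forall x, q' x <= q x) -> q' = q.

Lemma exists_minimal_sublinear p : sublinear p ->
  exists2 q, minimal_sublinear q & forall x, q x <= p x.
Proof.
move=> sp; pose T := {q : V -> R | sublinear q /\ forall x, q x <= p x}.
pose above (q q' : T) := `[< forall x, sval q' x <= sval q x >].
have [|||C Ctot|[q [sq qp]] qmin] := @Zorn T above.
- by move=> q; apply/asboolP.
- move=> q1 q2 q3 /asboolP q12 /asboolP q23; apply/asboolP => x.
  exact: le_trans (q23 x) (q12 x).
- move=> [q1 q1P] [q2 q2P] /asboolP q12 /asboolP q21; apply: eq_exist.
  by apply/funext => x; apply/eqP; rewrite eq_le q21 q12.
- have [->|/set0P[[q0 q0P] Cq0]] := eqVneq C set0.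
    by exists (exist _ p (conj sp (fun x => lexx (p x)))).
  pose D := [set sval q | q in C].
  have [|_ [q Cq <-]|_ _ [q Cq <-] [q' Cq' <-]|sinf infle] :=
    @sublinear_chain_inf D p.
  + by exists q0, (exist _ q0 q0P).
  + exact: svalP q.
  + by have [/asboolP|/asboolP] := Ctot q q' Cq Cq'; [right|left].
  + have infp x : inf [set q x | q in D] <= p x.
      rewrite (le_trans (infle q0 x _))//; last exact: q0P.2.
      by exists (exist _ q0 q0P).
    exists (exist _ (fun x => inf [set q x | q in D]) (conj sinf infp)) => q Cq.
    by apply/asboolP => x; apply: infle; exists q.
- exists q => //; split=> // q' sq' q'q.
  have q'p x : q' x <= p x := le_trans (q'q x) (qp x).
  by have /(congr1 sval) := qmin (exist _ q' (conj sq' q'p)) (asboolT q'q).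
Qed.

Lemma minimal_sublinear_scalar q : minimal_sublinear q -> scalar q.
Proof.
move=> [sq qmin]; have qD x y : q (x + y) = q x + q y.
  apply/eqP; rewrite eq_le sq.1 /= -lerBrDr.
  have q_fixed : reduce_along q y = q.
    apply: qmin => [|z]; first exact: sublinear_reduce_along.
    exact: reduce_along_le_self.
  by have := reduce_along_le y x sq ler01; rewrite q_fixed scale1r mul1r.
have qN x : q (- x) = - q x.
  by have := qD x (- x); rewrite subrr sublinear0//; lra.
move=> a x y; rewrite qD; congr (_ + _).
have [a0|/ltW a0] := leP 0 a; first exact: sublinearZ.
by rewrite -[a]opprK scaleNr qN sublinearZ ?oppr_ge0// !mulNr.
Qed.

Theorem Hahn_Banach_support p v : sublinear p ->
  exists f : {scalar V}, (forall x, f x <= p x) /\ f v = p v.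
Proof.
move=> sp.
have [q qmin qp] := exists_minimal_sublinear (sublinear_reduce_along v sp).
pose f : {scalar V} := HB.pack q
  (GRing.isLinear.Build R V R *%R q (minimal_sublinear_scalar qmin)).
have fp x : f x <= p x := le_trans (qp x) (reduce_along_le_self v x sp).
have fNv : f (- v) <= - p v.
  rewrite (le_trans (qp _))// (le_trans (reduce_along_le v (- v) sp ler01))//.
  by rewrite scale1r addNr sublinear0// mul1r sub0r.
by exists f; split=> //; apply/eqP; rewrite eq_le fp -lerN2 -raddfN.
Qed.

End Sublinear.

(** * Real and complex scalars *)

Definition restrict_scalars (A B : pzRingType) (f : {rmorphism A -> B})
  (V : lmodType B) : Type := V.

Section RestrictScalars.
Variables (A B : pzRingType) (f : {rmorphism A -> B}) (V : lmodType B).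
Local Notation W := (restrict_scalars f V).

HB.instance Definition _ := GRing.Zmodule.copy W V.

Let rscale (a : A) (v : W) : W := f a *: (v : V).

Let rscaleA a b v : rscale a (rscale b v) = rscale (a * b) v.
Proof. by rewrite /rscale scalerA rmorphM. Qed.

Let rscale1 : left_id 1 rscale.
Proof. by move=> v; rewrite /rscale rmorph1 scale1r. Qed.

Let rscaleDr : right_distributive rscale +%R.
Proof. by move=> a v w; rewrite /rscale scalerDr. Qed.

Let rscaleDl v : {morph rscale^~ v : a b / a + b}.
Proof. by move=> a b; rewrite /rscale rmorphD scalerDl. Qed.

HB.instance Definition _ :=
  GRing.Zmodule_isLmodule.Build A W rscaleA rscale1 rscaleDr rscaleDl.

Lemma restrict_scalarsZ (a : A) (v : W) : a *: v = f a *: (v : V) :> V.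
Proof. by []. Qed.

End RestrictScalars.

(* What [R] and [R[i]] have in common as scalar fields.  [imu] is an imaginary
   unit when [K = R[i]] and [0] when [K = R]; the last law says that the norm of
   [K] comes from an inner product. *)
Record real_part (R : realType) (K : numFieldType) (re : K -> R) := RealPart {
  emb : {rmorphism R -> K};
  imu : K;
  reD : forall z w, re (z + w) = re z + re w;
  re_embM : forall a z, re (emb a * z) = a * re z;
  emb_ge0 : forall a, (0 <= emb a) = (0 <= a);
  emb_re : forall z, 0 <= z -> emb (re z) = z;
  re_imuE : forall z, z = emb (re z) - imu * emb (re (imu * z));
  re_sqr_norm1D :
    forall z, re (`|1 + z| ^+ 2) = 1 + 2 * re z + re (`|z| ^+ 2) }.

Lemma real_part_real (R : realType) : real_part (@id R).
Proof.
apply: (@RealPart R R id (idfun : {rmorphism R -> R}) 0) => //= z.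
- by rewrite mul0r subr0.
- by rewrite !real_normK ?num_real//; ring.
Qed.

Lemma real_part_complex (R : realType) : real_part (@Re R).
Proof.
apply: (@RealPart R R[i] (@Re R) (real_complex R : {rmorphism R -> R[i]}) 'i%C).
- by move=> [a b] [c d].
- by move=> a [c d] /=; rewrite mul0r subr0.
- by move=> a; rewrite ler0c.
- by move=> z /ger0_real; exact: RRe_real.
- by move=> [a b]; simpc.
- by move=> [a b]; rewrite -!add_Re2_Im2 /=; ring.
Qed.

(** * Norms as real numbers *)

Lemma sup_attained (R : realType) (A : set R) (m : R) :
  A m -> ubound A m -> sup A = m.
Proof.
move=> Am mub; apply/eqP; rewrite eq_le ge_sup//=; last by exists m.
by apply: ub_le_sup => //; exists m.
Qed.

Section RealPart.
Variables (R : realType) (K : numFieldType) (re : K -> R) (rp : real_part re).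
Local Notation emb := (emb rp).
Local Notation imu := (imu rp).
Local Notation nrm x := (re `|x|).

Lemma re1 : re 1 = 1.
Proof. by apply: (fmorph_inj emb); rewrite rmorph1 emb_re. Qed.

Lemma re_emb a : re (emb a) = a.
Proof. by rewrite -[emb a]mulr1 re_embM re1 mulr1. Qed.

Lemma re0 : re 0 = 0.
Proof. by rewrite -(rmorph0 emb) re_emb. Qed.

Lemma reN z : re (- z) = - re z.
Proof. by apply/eqP; rewrite -subr_eq0 opprK -(reD rp) addNr re0. Qed.

Lemma re_ext z w : (forall c, re (c * z) = re (c * w)) -> z = w.
Proof.
move=> zw; rewrite (re_imuE rp z) (re_imuE rp w) zw.
by have := zw 1; rewrite !mul1r => ->.
Qed.

Lemma exists_scalar_re (V : lmodType K) (f : {scalar restrict_scalars emb V}) :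
  exists g : {scalar V}, forall v, re (g v) = f v.
Proof.
pose g (v : V) : K := emb (f v) - imu * emb (f (imu *: v : V)).
have fZ a v : f (emb a *: v : V) = a * f v by exact: linearZ.
have fB v w : f (v - w : V) = f v - f w by exact: raddfB.
have re_g c v : re (c * g v) = f (c *: v : V).
  rewrite /g mulrBr mulrA (reD rp) reN ![_ * emb _]mulrC !re_embM.
  rewrite [in RHS](re_imuE rp c) scalerBl mulrC [imu * emb _]mulrC -scalerA.
  by rewrite fB !fZ [imu * c]mulrC [f _ * _]mulrC.
have glin : scalar g.
  move=> a v w; apply: re_ext => c.
  by rewrite re_g [in RHS]mulrDr mulrA (reD rp) !re_g scalerDr scalerA raddfD.
pose G : {scalar V} := HB.pack g (GRing.isLinear.Build K V K *%R g glin).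
exists G => v.
by have := re_g 1 v; rewrite mul1r scale1r.
Qed.

Lemma ler_emb a b : (emb a <= emb b) = (a <= b).
Proof. by rewrite -subr_ge0 -rmorphB emb_ge0 subr_ge0. Qed.

Lemma ltr_emb a b : (emb a < emb b) = (a < b).
Proof. by rewrite !lt_def ler_emb (inj_eq (fmorph_inj emb)). Qed.

Lemma emb_real a : emb a \is Num.real.
Proof. by rewrite realE -(rmorph0 emb) !ler_emb le_total. Qed.

Lemma ler_re z w : z <= w -> re z <= re w.
Proof.
rewrite -subr_ge0 => zw; rewrite -subr_ge0 -reN -(reD rp).
by rewrite -(emb_ge0 rp) emb_re.
Qed.

Lemma reM_ge0 z w : 0 <= z -> re (z * w) = re z * re w.
Proof. by move=> z0; rewrite -{1}(emb_re rp z0) re_embM. Qed.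

Section NormedZmod.
Variable V : normedZmodType K.
Implicit Types x y : V.

Lemma nrmE x : `|x| = emb (nrm x).
Proof. by rewrite emb_re. Qed.

Lemma nrm_ge0 x : 0 <= nrm x.
Proof. by rewrite -(emb_ge0 rp) -nrmE. Qed.

Lemma nrm_triangle x y : nrm (x + y) <= nrm x + nrm y.
Proof. by rewrite -(reD rp); apply: ler_re; exact: ler_normD. Qed.

Lemma nrm_eq0 x : (nrm x == 0) = (x == 0).
Proof. by rewrite -(inj_eq (fmorph_inj emb)) -nrmE rmorph0 normr_eq0. Qed.

Lemma nrm_gt0 x : (0 < nrm x) = (x != 0).
Proof. by rewrite lt_def nrm_eq0 nrm_ge0 andbT. Qed.

Lemma norm_lt_emb x a : (`|x| < emb a) = (nrm x < a).
Proof. by rewrite {1}nrmE ltr_emb. Qed.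

End NormedZmod.

Lemma nrmM (z w : K) : nrm (z * w) = nrm z * nrm w.
Proof. by rewrite normrM reM_ge0. Qed.

Lemma nrmZ (V : normedModType K) a (x : V) : nrm (a *: x) = nrm a * nrm x.
Proof. by rewrite normrZ reM_ge0. Qed.

Lemma nrm_emb a : nrm (emb a) = `|a|.
Proof.
have [a0|/ltW a0] := leP 0 a; first by rewrite !ger0_norm ?emb_ge0// re_emb.
rewrite -normrN -rmorphN ger0_norm ?emb_ge0 ?oppr_ge0//.
by rewrite re_emb ler0_norm.
Qed.

Lemma sqr_nrm1D z : nrm (1 + z) ^+ 2 = 1 + 2 * re z + nrm z ^+ 2.
Proof. by have := re_sqr_norm1D rp z; rewrite !expr2 !reM_ge0. Qed.

Lemma re_le_nrm z : re z <= nrm z.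
Proof.
have := nrm_triangle 1 z; rewrite normr1 re1 => norm1D.
have := ler_pM (nrm_ge0 _) (nrm_ge0 _) norm1D norm1D.
by rewrite -expr2 sqr_nrm1D; lra.
Qed.

Lemma norm_re_le_nrm z : `|re z| <= nrm z.
Proof. by rewrite ler_norml lerNl -reN re_le_nrm -normrN re_le_nrm. Qed.

Lemma exists_phase (z : K) : exists2 c : K, nrm c = 1 & re (c * z) = nrm z.
Proof.
have [->|z0] := eqVneq z 0.
  by exists 1; rewrite ?normr1 ?re1// mulr0 normr0.
exists (`|z| / z); last by rewrite divfK.
by rewrite normrM normfV normr_id divff ?normr_eq0// re1.
Qed.

Lemma cvg_nrmP (V : pseudoMetricNormedZmodType K) (T : Type)
    (F : set_system T) (FF : Filter F) (u : T -> V) (l : V) :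
  u @ F --> l <-> forall e : R, 0 < e -> \forall x \near F, nrm (l - u x) < e.
Proof.
split=> [/cvgrPdist_lt ul e e0|ul].
  have /ul : 0 < emb e by rewrite -(rmorph0 emb) ltr_emb.
  by apply: filterS => x; rewrite norm_lt_emb.
apply/cvgrPdist_lt => e e0; rewrite -(emb_re rp (ltW e0)).
have /ul : 0 < re e by rewrite -ltr_emb rmorph0 emb_re// ltW.
by apply: filterS => x; rewrite norm_lt_emb.
Qed.

Lemma re_continuous : continuous (re : K -> R).
Proof.
move=> z; apply/(@cvgrPdist_lt _ _ _ (nbhs z)) => e e0.
have := (cvg_nrmP (nbhs_filter z) id z).1 cvg_id e e0.
apply: filterS => w; apply: le_lt_trans.
by rewrite -reN -(reD rp) norm_re_le_nrm.
Qed.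

Lemma emb_continuous : continuous (emb : R -> K).
Proof.
move=> a; apply/(cvg_nrmP (nbhs_filter a)) => e e0.
have := (@cvgrPdist_lt _ _ _ _ (nbhs_filter a) id a).1 cvg_id e e0.
by apply: filterS => b; rewrite -rmorphB nrm_emb.
Qed.

Lemma cvg_re (T : Type) (F : set_system T) (u : T -> K) (l : K) :
  u @ F --> l -> re (u x) @[x --> F] --> re l.
Proof. by move=> ul; exact: cvg_comp ul (@re_continuous l). Qed.

Lemma cvg_nrm (T : Type) (F : set_system T) (FF : Filter F) (u : T -> K)
    (l : K) :
  u @ F --> l -> nrm (u x) @[x --> F] --> nrm l.
Proof. by move=> /cvg_norm; exact: cvg_re. Qed.

Lemma cvg1_nrm_re (T : Type) (F : set_system T) (FF : Filter F) (u : T -> K)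
    (a b : T -> R) :
  a @ F --> (1 : R) -> b @ F --> (1 : R) ->
  (forall x, nrm (u x) <= a x) -> (forall x, b x <= re (u x)) ->
  u @ F --> (1 : K).
Proof.
move=> a1 b1 ua bu; apply/cvg_nrmP => e e0.
have sqr_bound x : nrm (1 - u x) ^+ 2 <= a x * a x - 2 * b x + 1.
  have := ler_pM (nrm_ge0 _) (nrm_ge0 _) (ua x) (ua x); have := bu x.
  by rewrite sqr_nrm1D reN normrN expr2; lra.
have bound_cvg : a x * a x - 2 * b x + 1 @[x --> F] --> (1 * 1 - 2 * 1 + 1 : R).
  apply: cvgD; last exact: cvg_cst.
  by apply: cvgB; apply: cvgM => //; exact: cvg_cst.
have bound_lt : 1 * 1 - 2 * 1 + 1 < e ^+ 2.
  by have := exprn_gt0 2 e0; lra.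
have : \forall x \near F, a x * a x - 2 * b x + 1 < e ^+ 2.
  exact: cvgr_lt bound_cvg _ bound_lt.
apply: filterS => x /(le_lt_trans (sqr_bound x)).
by rewrite ltr_pXn2r// nnegrE ?nrm_ge0// ltW.
Qed.

End RealPart.

(** * Limits along ultrafilters *)

Lemma fmap_ultra (S T : Type) (f : S -> T) (U : set_system S) :
  UltraFilter U -> UltraFilter (f @ U).
Proof.
move=> UU; split; first exact: fmap_proper_filter.
move=> G GF UG; apply/seteqP; split=> // A GA.
have [//|UnA] := in_ultra_setVsetC (f @^-1` A) UU.
exfalso; apply: (@filter_not_empty _ G).
by rewrite -(setICr A); apply: filterI => //; exact: UG.
Qed.

Lemma ultra_bounded_cvg (R : realType) (I : Type) (U : set_system I)
    (u : I -> R) (M : R) :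
  UltraFilter U -> (forall i, `|u i| <= M) -> cvg (u @ U).
Proof.
move=> UU uM; have uU : (u @ U) [set` `[- M, M]].
  by apply: (@filterE _ U) => i; rewrite /= in_itv/= -ler_norml.
have := @segment_compact R (- M) M; rewrite compact_ultra /=.
by move=> /(_ _ (fmap_ultra u UU) uU)[l [_ ul]]; apply/cvg_ex; exists l.
Qed.

Lemma ultra_nrm_bounded_cvg (R : realType) (K : numFieldType) (re : K -> R)
    (rp : real_part re) (I : Type) (U : set_system I) (u : I -> K) (M : R) :
  UltraFilter U -> (forall i, re `|u i| <= M) -> cvg (u @ U).
Proof.
move=> UU uM.
have re_cvg c : exists l, emb rp (re (c * u i)) @[i --> U] --> emb rp l.
  have cuM i : `|re (c * u i)| <= re `|c| * M.
    rewrite (le_trans (norm_re_le_nrm rp _))// (nrmM rp).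
    by rewrite ler_wpM2l ?(nrm_ge0 rp).
  have /cvg_ex[l ul] := ultra_bounded_cvg UU cuM; exists l.
  exact: cvg_comp ul (@emb_continuous R K re rp l).
have [a ua] := re_cvg 1; have [b ub] := re_cvg (imu rp).
apply/cvg_ex; exists (emb rp a - imu rp * emb rp b).
have -> : u = fun i =>
    emb rp (re (1 * u i)) - imu rp * emb rp (re (imu rp * u i)).
  by apply/funext => i; rewrite mul1r -re_imuE.
apply: cvgB; first exact: ua.
apply: cvgM; last exact: ub.
exact: cvg_cst.
Qed.

(** * Bounded operators *)

Section BoundedOperators.
Variables (R : realType) (K : numFieldType) (re : K -> R) (rp : real_part re).
Local Notation emb := (emb rp).
Local Notation nrm x := (re `|x|).

Lemma exists_normalized (V : normedModType K) (x : V) : x != 0 ->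
  exists2 u, unit_sphere u & x = emb (nrm x) *: u.
Proof.
rewrite -normr_eq0 => x0; exists (`|x|^-1 *: x).
  by rewrite /unit_sphere /= normrZ normfV normr_id mulVf.
by rewrite -nrmE scalerA divff// scale1r.
Qed.

Section Operators.
Variables X Y : normedModType K.
Implicit Types S U : X -> Y.

Lemma exists_linear S : is_linear S ->
  exists f : {linear X -> Y}, f = S :> (X -> Y).
Proof.
move=> lS; pose f : {linear X -> Y} :=
  HB.pack S (GRing.isLinear.Build K X Y *:%R S lS).
by exists f.
Qed.

Lemma bounded_opP S : bounded_op S <->
  is_linear S /\ exists M : R, forall x, nrm (S x) <= M * nrm x.
Proof.
split=> -[lS bS]; split=> //; have [f fS] := exists_linear lS.
- move: bS; rewrite -fS.
  move=> /linear_bounded_continuous/linear_boundedP/pinfty_ex_gt0[r r0 fr].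
  by exists (re r) => x; rewrite -(reM_ge0 rp _ (ltW r0)); exact: (ler_re rp).
- have [M fM] := bS; rewrite -fS in fM *.
  apply/linear_bounded_continuous/linear_boundedP; near=> r => x.
  apply: (@le_trans _ _ (emb M * `|x|)).
    by rewrite (nrmE rp (f x)) [in leRHS](nrmE rp x) -rmorphM ler_emb.
  rewrite ler_wpM2r//; near: r; apply: nbhs_pinfty_ge; exact: emb_real.
Unshelve. all: by end_near. Qed.

Lemma bounded_opZ a S : bounded_op S -> bounded_op (fun x => a *: S x).
Proof.
move=> [lS cS]; split=> [b x y|x]; last exact: cvgZr (cS x).
by rewrite lS scalerDr !scalerA mulrC.
Qed.

Lemma bounded_op_lincomb a S U : bounded_op S -> bounded_op U ->
  bounded_op (fun x => a *: S x + U x).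
Proof.
move=> /(bounded_opZ a)[laS caS] [lU cU].
split=> [b x y|x]; last exact: cvgD (caS x) (cU x).
by rewrite laS lU scalerDr addrACA.
Qed.

Lemma bounded_op0 : bounded_op (fun _ : X => 0 : Y).
Proof. by split=> [a x y|x]; [rewrite scaler0 addr0|exact: cvg_cst]. Qed.

Lemma opnorm_le S x : bounded_op S -> nrm (S x) <= opnorm re S * nrm x.
Proof.
move=> /bounded_opP[/exists_linear[f <-] [M fM]].
have [->|/exists_normalized[u u1 ->]] := eqVneq x 0.
  by rewrite linear0 !normr0 (re0 rp) mulr0.
rewrite linearZ !(nrmZ rp) u1 (re1 rp) mulr1 mulrC ler_wpM2r ?(nrm_ge0 rp)//.
apply: ub_le_sup; last by exists u.
by exists M => _ [z z1 <-]; rewrite (le_trans (fM z))// z1 (re1 rp) mulr1.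
Qed.

Lemma opnorm_sphere_le S x : bounded_op S -> unit_sphere x ->
  nrm (S x) <= opnorm re S.
Proof.
by move=> bS x1; have := opnorm_le x bS; rewrite x1 (re1 rp) mulr1.
Qed.

End Operators.

Section Functionals.
Variable Y : normedModType K.

Lemma functional_norm_le (g : Y -> K) y : bounded_functional g ->
  nrm (g y) <= functional_norm re g * nrm y.
Proof. exact: (@opnorm_le Y K^o). Qed.

Lemma dual_sphere_le (g : Y -> K) y : dual_sphere re g -> nrm (g y) <= nrm y.
Proof.
by move=> [bg g1]; have := functional_norm_le y bg; rewrite g1 mul1r.
Qed.

Lemma norming_functional (y : Y) : y != 0 ->
  exists2 g : Y -> K, dual_sphere re g & re (g y) = nrm y.
Proof.
move=> y0; pose p (v : restrict_scalars emb Y) : R := nrm (v : Y).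
have [|f [fp fy]] := @Hahn_Banach_support R _ p y.
  split=> [v w|a v a0]; first exact: nrm_triangle.
  by rewrite /p restrict_scalarsZ (nrmZ rp) (nrm_emb rp) gtr0_norm.
have [g gf] := exists_scalar_re f.
have g_le v : nrm (g v) <= nrm v.
  have [c c1 <-] := exists_phase rp (g v).
  rewrite -[c * _]/(c *: _) -linearZ /= gf (le_trans (fp _))// /p.
  by rewrite (nrmZ rp c (v : Y)) c1 mul1r.
have bg : bounded_functional g.
  apply/(@bounded_opP Y K^o); split; first exact: linearP.
  by exists 1 => v; rewrite mul1r.
exists g; last by rewrite gf fy.
have [u u1 yu] := exists_normalized y0.
have gy : nrm (g y) = nrm y.
  by apply/le_anti; rewrite g_le -[X in X <= _]fy -gf re_le_nrm.
split=> //; apply: sup_attained.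
- exists u => //; move: gy; rewrite {1}yu linearZ (nrmM rp) (nrm_emb rp).
  rewrite ger0_norm ?(nrm_ge0 rp)// -[RHS]mulr1.
  by apply: mulfI; rewrite (nrm_eq0 rp).
- by move=> _ [z z1 <-]; rewrite (le_trans (g_le z))// z1 (re1 rp).
Qed.

End Functionals.

Section OperatorFunctionals.
Variables X Y : normedModType K.
Implicit Types (S U : X -> Y) (f g : (X -> Y) -> K).

Lemma nrm_psi_le_opnorm S x y' : bounded_op S -> unit_sphere x ->
  dual_sphere re y' -> nrm (psi x y' S) <= opnorm re S.
Proof.
move=> bS x1 y'1; rewrite (le_trans (dual_sphere_le _ y'1))//.
exact: opnorm_sphere_le.
Qed.

Definition op_linear f : Prop :=
  forall a S U, bounded_op S -> bounded_op U ->
    f (fun x => a *: S x + U x) = a * f S + f U.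

Lemma op_linearZ f a S : op_linear f -> bounded_op S ->
  f (fun x => a *: S x) = a * f S.
Proof.
move=> lf bS; have b0 := bounded_op0 X Y.
have f0 : f (fun=> 0) = 0.
  have := lf (-1) _ _ b0 b0.
  under eq_fun do rewrite scaler0 addr0.
  by rewrite mulN1r addNr.
have := lf a _ _ bS b0; rewrite f0 addr0 => <-.
by under [in RHS]eq_fun do rewrite addr0.
Qed.

Lemma op_linear_re_le f g : op_linear f -> op_linear g ->
  (forall S, bounded_op S -> re (g S) <= re (f S)) ->
  forall S, bounded_op S -> g S = f S.
Proof.
move=> lf lg gf S bS; apply/eqP; rewrite -subr_eq0 -(nrm_eq0 rp).
rewrite eq_le (nrm_ge0 rp) andbT; have [c _ <-] := exists_phase rp (g S - f S).
rewrite mulrBr -!op_linearZ// (reD rp) (reN rp) subr_le0.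
by apply: gf; exact: bounded_opZ.
Qed.

End OperatorFunctionals.
End BoundedOperators.

(** * Nets and filters *)

Section NetFilter.
Variables (I : Type) (le : I -> I -> Prop).

Definition net_filter : set_system I :=
  [set A | exists i0, forall i, le i0 i -> A i].

Hypothesis dle : directed le.

Lemma net_filter_proper : ProperFilter net_filter.
Proof.
have [le_refl le_tr [i _] le_dir] := dle; split.
  by move=> [j /(_ j (le_refl j))].
split=> [|A B [j Aj] [k Bk]|A B AB [j Aj]].
- by exists i.
- have [l [jl kl]] := le_dir j k.
  exists l => m lm; split; first exact/Aj/(le_tr _ _ _ jl).
  exact/Bk/(le_tr _ _ _ kl).
- by exists j => k /Aj /AB.
Qed.

Lemma net_cvgE (V : numFieldType) (u : I -> V) (l : V) :
  net_cvg le u l <-> u @ net_filter --> l.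
Proof.
have := net_filter_proper => FF; split=> [ul|/cvgrPdist_lt ul e /ul[i0 ul_i0]].
- apply/cvgrPdist_lt => e /ul[i0 ul_i0].
  by exists i0 => i /ul_i0; rewrite distrC.
- by exists i0 => i /ul_i0; rewrite distrC.
Qed.

End NetFilter.

Section FilterNet.
Variables (T : Type) (F : set_system T).

Definition filter_index : Type := {Ax : set T * T | F Ax.1 /\ Ax.1 Ax.2}.

Definition filter_index_le (i j : filter_index) : Prop :=
  (sval j).1 `<=` (sval i).1.

Definition filter_net (i : filter_index) : T := (sval i).2.

Hypothesis PF : ProperFilter F.

Lemma exists_filter_index (A : set T) : F A ->
  exists i : filter_index, (sval i).1 = A.
Proof.
move=> FA; have [x Ax] := filter_ex FA.
by exists (exist (fun Ax => F Ax.1 /\ Ax.1 Ax.2) (A, x) (conj FA Ax)).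
Qed.

Lemma filter_index_directed : directed filter_index_le.
Proof.
split=> [i|i j k ij jk||i j].
- exact: subset_refl.
- exact: subset_trans jk ij.
- by have [i _] := exists_filter_index filterT; exists i.
- have [k kE] := exists_filter_index (filterI (svalP i).1 (svalP j).1).
  by exists k; rewrite /filter_index_le kE; split=> [x []|x []].
Qed.

Lemma fmap_filter_net : filter_net @ net_filter filter_index_le = F.
Proof.
apply/seteqP; split=> A.
- move=> [i iA]; apply: filterS (svalP i).1 => x ix.
  by apply: (iA (exist _ ((sval i).1, x) (conj (svalP i).1 ix))).
- move=> FA; have [i iE] := exists_filter_index FA.
  by exists i => j; rewrite /filter_index_le iE; apply; exact: (svalP j).2.
Qed.

End FilterNet.

(** * The G-norm *)

Section GNorm.
Variables (R : realType) (K : numFieldType) (re : K -> R) (rp : real_part re).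
Variables (X Y : normedModType K) (G : X -> Y).
Hypotheses (bG : bounded_op G) (G1 : opnorm re G = 1).
Local Notation nrm x := (re `|x|).
Local Notation Gn := (Gnorm re G).
Implicit Types (S T U : X -> Y) (c d e r t : R) (f phi : (X -> Y) -> K).

Definition slice d : set X :=
  [set x | x \in @unit_sphere K X /\ 1 - d < nrm (G x)].

Definition slice_norm S d : R := sup [set nrm (S x) | x in slice d].

Lemma slice_nonempty d : 0 < d -> slice d !=set0.
Proof.
move=> d0; have [||_ [x x1 <-] Gx] :=
  @sup_gt _ [set nrm (G x) | x in @unit_sphere K X] (1 - d).
- apply/set0P/negP => /eqP sphere0; move: G1.
  by rewrite /opnorm sphere0 sup0 => /eqP; rewrite eq_sym oner_eq0.
- by rewrite -/(opnorm re G) G1 ltrBlDr ltrDl.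
- by exists x; split; first exact: mem_set.
Qed.

Lemma sub_slice d e : d <= e -> slice d `<=` slice e.
Proof.
by move=> de x [x1 Gx]; split=> //; apply: le_lt_trans Gx; rewrite lerB.
Qed.

Lemma le_slice_norm S d x : bounded_op S -> slice d x ->
  nrm (S x) <= slice_norm S d.
Proof.
move=> bS dx; apply: ub_le_sup; last by exists x.
exists (opnorm re S) => _ [z [/set_mem z1 _] <-].
exact: (opnorm_sphere_le rp).
Qed.

Lemma slice_norm_ge0 S d : bounded_op S -> 0 < d -> 0 <= slice_norm S d.
Proof.
move=> bS d0; have [x dx] := slice_nonempty d0.
by rewrite (le_trans (nrm_ge0 rp (S x)))// le_slice_norm.
Qed.

Lemma Gnorm_le_slice_norm S d : bounded_op S -> 0 < d -> Gn S <= slice_norm S d.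
Proof.
move=> bS d0; apply: ge_inf; last by exists d.
by exists 0 => _ [e e0 <-]; exact: slice_norm_ge0.
Qed.

Lemma Gnorm_ge S c : (forall d, 0 < d -> c <= slice_norm S d) -> c <= Gn S.
Proof.
move=> cS; apply: lb_le_inf; first by exists (slice_norm S 1), 1 => /=.
by move=> _ [d d0 <-]; exact: cS.
Qed.

Lemma Gnorm_ge0 S : bounded_op S -> 0 <= Gn S.
Proof. by move=> bS; apply: Gnorm_ge => d; exact: slice_norm_ge0. Qed.

Lemma Gnorm_gt_slice S c d : bounded_op S -> c < Gn S -> 0 < d ->
  exists2 x, slice d x & c < nrm (S x).
Proof.
move=> bS cS d0.
have [|_ [x dx <-]] := sup_gt _ (lt_le_trans cS (Gnorm_le_slice_norm bS d0)).
  by have [x dx] := slice_nonempty d0; exists (nrm (S x)), x.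
by exists x.
Qed.

Lemma Gnorm_lt_slice S c : bounded_op S -> Gn S < c ->
  exists2 d, 0 < d & forall x, slice d x -> nrm (S x) < c.
Proof.
move=> bS Sc; have [|_ [d d0 <-] dc] := inf_lt _ Sc.
  by exists (slice_norm S 1), 1 => /=.
by exists d => // x dx; apply: le_lt_trans dc; exact: le_slice_norm.
Qed.

Lemma Gnorm_gt_psi S c d : bounded_op S -> 0 <= c -> c < Gn S -> 0 < d ->
  exists x y', [/\ slice d x, dual_sphere re y' & c < re (psi x y' S)].
Proof.
move=> bS c0 cS d0; have [x dx cx] := Gnorm_gt_slice bS cS d0.
have [|y' y'1 y'x] := norming_functional rp (y := S x).
  by rewrite -(nrm_gt0 rp) (le_lt_trans c0).
by exists x, y'; split=> //; rewrite /psi y'x.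
Qed.

Lemma Gdual_functional_le f S : Gnorm_is_norm re G -> Gdual_functional re G f ->
  bounded_op S -> nrm (f S) <= Gdual_norm re G f * Gn S.
Proof.
move=> [_ GnZ _] [lf [C fC]] bS.
have := Gnorm_ge0 bS; rewrite le_eqVlt => /predU1P[S0|S0].
  by have := fC _ bS; rewrite -S0 !mulr0.
pose a := emb rp (Gn S)^-1.
have aE : nrm a = (Gn S)^-1 by rewrite nrm_emb gtr0_norm ?invr_gt0.
rewrite -ler_pdivrMr// mulrC -aE -(nrmM rp) -op_linearZ//.
apply: ub_le_sup; last first.
  exists (fun x => a *: S x) => //; split; first exact: bounded_opZ.
  by rewrite GnZ// aE mulVf// gt_eqF.
exists `|C| => _ [U [bU U1] <-]; rewrite (le_trans (fC _ bU))//.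
rewrite (le_trans (ler_wpM2r (Gnorm_ge0 bU) (ler_norm C)))//.
by rewrite ler_piMr.
Qed.

Lemma mem_Gdual_sphere f T : op_linear f -> bounded_op T -> Gn T = 1 ->
  f T = 1 -> (forall S, bounded_op S -> nrm (f S) <= Gn S) ->
  Gdual_sphere re G f.
Proof.
move=> lf bT T1 fT f_le.
split; first by split=> //; exists 1 => S bS; rewrite mul1r; exact: f_le.
apply: sup_attained; first by exists T; rewrite /= ?T1// fT normr1 (re1 rp).
by move=> _ [S [bS S1] <-]; rewrite (le_trans (f_le _ bS)).
Qed.

(** * The set W(T) *)

Lemma W_setP T phi : W_set re G T phi <->
  exists (I : Type) (F : set_system I) (xs : I -> X) (ys : I -> Y -> K),
    [/\ ProperFilter F,
        forall i, unit_sphere (xs i) /\ dual_sphere re (ys i),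
        nrm (G (xs i)) @[i --> F] --> (1 : R),
        psi (xs i) (ys i) T @[i --> F] --> (1 : K) &
        forall S, bounded_op S -> psi (xs i) (ys i) S @[i --> F] --> phi S].
Proof.
split.
- move=> [I [le [xs [ys [dle sph Gx Tx phix]]]]].
  exists I, (net_filter le), xs, ys; split.
  + exact: net_filter_proper.
  + by move=> i; have [/set_mem ? /set_mem] := sph i.
  + exact/net_cvgE.
  + exact/net_cvgE.
  + by move=> S /phix /net_cvgE; exact.
- move=> [I [F [xs [ys [PF sph Gx Tx phix]]]]].
  exists (filter_index F), (@filter_index_le _ F), (xs \o @filter_net _ F),
    (ys \o @filter_net _ F).
  have dle := filter_index_directed PF; have PN := net_filter_proper dle.
  have net_cvg_comp (V : numFieldType) (u : I -> V) l : u @ F --> l ->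
      net_cvg (@filter_index_le _ F) (u \o @filter_net _ F) l.
    by move=> ul; apply/(net_cvgE dle); rewrite fmap_comp fmap_filter_net.
  split=> // [i|||S /phix].
  + by have [x1 y1] := sph (filter_net i); split; exact: mem_set.
  + exact: net_cvg_comp Gx.
  + exact: net_cvg_comp Tx.
  + exact: net_cvg_comp.
Qed.

Lemma W_set_normalized T phi : bounded_op T -> W_set re G T phi -> phi T = 1.
Proof.
move=> bT /W_setP[I [F [xs [ys [PF _ _ Tx phix]]]]].
exact: cvg_unique (phix T bT) Tx.
Qed.

Lemma W_set_op_linear T phi : W_set re G T phi -> op_linear phi.
Proof.
move=> /W_setP[I [F [xs [ys [PF sph _ _ phix]]]]] a S U bS bU.
apply: (cvg_unique _ (phix _ (bounded_op_lincomb a bS bU))) => //.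
have psi_lincomb i : psi (xs i) (ys i) (fun x => a *: S x + U x) =
    a * psi (xs i) (ys i) S + psi (xs i) (ys i) U.
  by rewrite /psi (sph i).2.1.1.
rewrite (funext psi_lincomb); apply: cvgD; last exact: phix.
by apply: cvgM; [exact: cvg_cst|exact: phix].
Qed.

Lemma W_set_le_Gnorm T phi S : W_set re G T phi -> bounded_op S ->
  nrm (phi S) <= Gn S.
Proof.
move=> /W_setP[I [F [xs [ys [PF sph Gx _ phix]]]]] bS; apply: Gnorm_ge => d d0.
apply: (cvgr_to_le (cvg_nrm rp _ (phix S bS))).
have : \forall i \near F, 1 - d < nrm (G (xs i)).
  by apply: (cvgr_gt _ Gx); rewrite ltrBlDr ltrDl.
apply: filterS => i Gxi; rewrite (le_trans (dual_sphere_le rp _ (sph i).2))//.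
by apply: le_slice_norm => //; split=> //; exact/mem_set/(sph i).1.
Qed.

Lemma W_set_Gdual_sphere T phi : bounded_op T -> Gn T = 1 ->
  W_set re G T phi -> Gdual_sphere re G phi.
Proof.
move=> bT T1 Wphi; apply: (mem_Gdual_sphere (T := T)) => //.
- exact: W_set_op_linear Wphi.
- exact: W_set_normalized Wphi.
- by move=> S; exact: W_set_le_Gnorm Wphi.
Qed.

Lemma ultra_W_set T (I : Type) (U : set_system I) (xs : I -> X)
    (ys : I -> Y -> K) :
  UltraFilter U ->
  (forall i, unit_sphere (xs i) /\ dual_sphere re (ys i)) ->
  nrm (G (xs i)) @[i --> U] --> (1 : R) ->
  psi (xs i) (ys i) T @[i --> U] --> (1 : K) ->
  exists2 phi, W_set re G T phi &
    forall S, bounded_op S -> psi (xs i) (ys i) S @[i --> U] --> phi S.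
Proof.
move=> UU sph Gx Tx; pose phi S := lim (psi (xs i) (ys i) S @[i --> U]).
have phix S : bounded_op S -> psi (xs i) (ys i) S @[i --> U] --> phi S.
  move=> bS; apply: (ultra_nrm_bounded_cvg rp (M := opnorm re S)) => i.
  by have [x1 y1] := sph i; exact: nrm_psi_le_opnorm.
exists phi => //; apply/W_setP; exists I, U, xs, ys.
by split=> //; exact: ultra_proper.
Qed.

(* Since [||T + t S||_G] is convex in [t], this says that its right derivative
   at [0] is at least [r]. *)
Definition Gnorm_slope_ge S T r : Prop :=
  forall t, 0 < t -> Gn T + t * r <= Gn (fun x => emb rp t *: S x + T x).

Lemma Gnorm_slope_psi S T r t :
  bounded_op S -> bounded_op T -> Gnorm_slope_ge S T r ->
  0 < t -> 0 <= Gn T + t * r - t ^+ 2 ->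
  exists x y', [/\ slice t x, dual_sphere re y',
    nrm (psi x y' T) <= Gn T + t ^+ 2 &
    Gn T + t * r - t ^+ 2 <= t * re (psi x y' S) + re (psi x y' T)].
Proof.
move=> bS bT slope_ge t0 attained_ge0.
have t20 : 0 < t ^+ 2 := exprn_gt0 2 t0.
have [d d0 Td] : exists2 d, 0 < d &
    forall x, slice d x -> nrm (T x) < Gn T + t ^+ 2.
  by apply: Gnorm_lt_slice => //; rewrite ltrDl.
have [|||x [y' [dx y'1 attained]]] := @Gnorm_gt_psi _ (Gn T + t * r - t ^+ 2)
  (Num.min d t) (bounded_op_lincomb (emb rp t) bS bT) => //.
- by rewrite (lt_le_trans _ (slope_ge t t0))// ltrBlDr ltrDl.
- by rewrite lt_min d0.
exists x, y'; split=> //.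
- by apply: sub_slice dx; rewrite ge_min lexx orbT.
- rewrite (le_trans (dual_sphere_le rp _ y'1))// ltW// Td//.
  by apply: sub_slice dx; rewrite ge_min lexx.
- by move: attained; rewrite /psi y'1.1.1 (reD rp) re_embM => /ltW.
Qed.

Definition near_support S T r e (x : X) (y' : Y -> K) : Prop :=
  [/\ slice e x, dual_sphere re y', nrm (psi x y' T) <= 1 + e,
      1 - e <= re (psi x y' T) & r - e <= re (psi x y' S)].

(* Of the value attained by [T + t S], which is at least [1 + t r - O(t^2)], the
   part of [T] is at most [1 + O(t^2)], which leaves [r - O(t)] for [S]; as the
   part of [t S] is [O(t)], the part of [T] is also at least [1 - O(t)]. *)
Lemma Gnorm_slope_near_support S T r e :
  bounded_op S -> bounded_op T -> Gn T = 1 -> Gnorm_slope_ge S T r -> 0 < e ->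
  exists x y', near_support S T r e x y'.
Proof.
move=> bS bT T1 slope_ge e0; set M := opnorm re S.
have denom_gt0 : 0 < `|r| + `|M| + 2 by rewrite ltr_wpDl ?addr_ge0.
pose t := Num.min e 1 / (`|r| + `|M| + 2).
have t0 : 0 < t by rewrite divr_gt0// lt_min e0 ltr01.
have [te t1] : t * (`|r| + `|M| + 2) <= e /\ t * (`|r| + `|M| + 2) <= 1.
  by rewrite divfK ?gt_eqF// !ge_min !lexx orbT.
have tr : - (t * `|r|) <= t * r <= t * `|r|.
  by rewrite -ler_norml normrM gtr0_norm.
have tr0 := mulr_ge0 (ltW t0) (normr_ge0 r).
have tM0 := mulr_ge0 (ltW t0) (normr_ge0 M).
have := Gnorm_slope_psi bS bT slope_ge t0; rewrite T1.
case=> [|x [y' [tx y'1 Tx TSx]]]; first by nra.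
have tSx : t * re (psi x y' S) <= t * `|M|.
  rewrite ler_wpM2l ?(ltW t0)// (le_trans (re_le_nrm rp _))//.
  rewrite (le_trans _ (ler_norm M))// nrm_psi_le_opnorm//.
  exact: set_mem tx.1.
have reTx := le_trans (re_le_nrm rp _) Tx.
exists x, y'; split=> //.
- by apply: sub_slice tx; nra.
- by nra.
- by nra.
- by rewrite -(ler_pM2l t0); nra.
Qed.

Lemma near_support_W_set S T r : bounded_op S ->
  (forall e, 0 < e -> exists x y', near_support S T r e x y') ->
  exists2 phi, W_set re G T phi & r <= re (phi S).
Proof.
move=> bS near.
have /choice[p pP] : forall n, exists p : X * (Y -> K),
    near_support S T r (harmonic n) p.1 p.2.
  by move=> n; have [x [y' xy']] := near _ (harmonic_gt0 n); exists (x, y').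
have [U [UU ooU]] := @ultraFilterLemma nat \oo _.
have harmonicU : @harmonic R @ U --> 0 := fun A nA => ooU _ (cvg_harmonic nA).
have cB_U c : c - @harmonic R n @[n --> U] --> c.
  by rewrite -[X in _ --> X]subr0; apply: cvgB => //; exact: cvg_cst.
have cD_U c : c + @harmonic R n @[n --> U] --> c.
  by rewrite -[X in _ --> X]addr0; apply: cvgD => //; exact: cvg_cst.
have sph n : unit_sphere (p n).1 /\ dual_sphere re (p n).2.
  by have [[/set_mem]] := pP n.
have Gp : nrm (G (p n).1) @[n --> U] --> (1 : R).
  apply: squeeze_cvgr (cB_U 1) (cvg_cst _); apply: nearW => n.
  have [[_ /ltW ->] _ _ _ _] := pP n.
  by rewrite -G1; apply: (opnorm_sphere_le rp) => //; exact: (sph n).1.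
have Tp : psi (p n).1 (p n).2 T @[n --> U] --> (1 : K).
  by apply: (cvg1_nrm_re rp _ (cD_U 1) (cB_U 1)) => n; have [] := pP n.
have [phi Wphi phip] := ultra_W_set UU sph Gp Tp.
exists phi => //; apply: (ler_cvg_to (cB_U r) (cvg_re rp (phip S bS))).
by apply: nearW => n; have [] := pP n.
Qed.

Lemma Gnorm_slope_W_set S T r :
  bounded_op S -> bounded_op T -> Gn T = 1 -> Gnorm_slope_ge S T r ->
  exists2 phi, W_set re G T phi & r <= re (phi S).
Proof.
move=> bS bT T1 slope_ge; apply: near_support_W_set => // e.
exact: Gnorm_slope_near_support.
Qed.

Lemma Gnorm_slope_ge0 T : Gnorm_slope_ge (fun=> 0) T 0.
Proof.
move=> t _; under [in leRHS]eq_fun do rewrite scaler0 add0r.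
by rewrite mulr0 addr0.
Qed.

Lemma Gdual_sphere_slope f S T : Gnorm_is_norm re G -> Gdual_sphere re G f ->
  bounded_op S -> bounded_op T -> Gn T = 1 -> f T = 1 ->
  Gnorm_slope_ge S T (re (f S)).
Proof.
move=> Gnn [bf f1] bS bT T1 fT t t0.
have := Gdual_functional_le Gnn bf (bounded_op_lincomb (emb rp t) bS bT).
rewrite f1 mul1r; apply: le_trans; rewrite (le_trans _ (re_le_nrm rp _))//.
by rewrite bf.1// fT (reD rp) re_embM (re1 rp) T1 addrC.
Qed.

Theorem smooth_iff_W_singleton T : Gnorm_is_norm re G -> bounded_op T ->
  Gn T = 1 ->
  smooth_point re G T <->
  exists phi, W_singleton re G T phi /\ phi T = 1.
Proof.
move=> Gnn bT T1; split.
- move=> [_ [f [_ [_ f_uniq]]]].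
  have W_eq phi : W_set re G T phi -> forall S, bounded_op S -> phi S = f S.
    move=> Wphi; apply: f_uniq; last exact: W_set_normalized Wphi.
    exact/mem_set/(W_set_Gdual_sphere bT T1).
  have [phi Wphi _] :=
    Gnorm_slope_W_set (bounded_op0 X Y) bT T1 (Gnorm_slope_ge0 T).
  exists phi; split; last exact: W_set_normalized Wphi.
  split; first exact: mem_set.
  by move=> phi' /set_mem Wphi' S bS; rewrite !W_eq.
- move=> [phi [[/set_mem Wphi phi_uniq] phiT]].
  split=> //; exists phi; split; first exact/mem_set/(W_set_Gdual_sphere bT T1).
  split=> // g /set_mem gD gT.
  apply: (op_linear_re_le rp) gD.1.1 _ => [|S bS].
    exact: W_set_op_linear Wphi.
  have [phi' Wphi' phi'_ge] :=
    Gnorm_slope_W_set bS bT T1 (Gdual_sphere_slope Gnn gD bS bT T1 gT).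
  by rewrite -(phi_uniq phi')//; exact: mem_set.
Qed.

End GNorm.

Theorem theorem3p11 (R : realType) :
  thm311_claim (K := R) (@id R) /\ thm311_claim (K := R[i]) (@Re R).
Proof.
split=> X Y G T bG G1 Gnn bT T1.
- exact: (smooth_iff_W_singleton (real_part_real R)).
- exact: (smooth_iff_W_singleton (real_part_complex R)).
Qed.
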